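(* Let $\Delta x,\Delta t>0$, let $(\widetilde w_i^n)_{i\in\mathbb Z}\subset\widetilde\Omega$, $\widetilde w_i^n=(w_i^n,z_i)$, and let $\widehat{\mathcal W}_R$ be the approximate Riemann solver defined in the context, with wave speeds satisfying $\lambda_L<0<\lambda_R$, $\lambda_L<u_L$ and $\lambda_R>u_R$ for every pair of data. Assume the CFL restriction $$\frac{\Delta t}{\Delta x}\max\big(|\lambda_L(\widetilde w_i^n,\widetilde w_{i+1}^n)|,|\lambda_R(\widetilde w_i^n,\widetilde w_{i+1}^n)|\big)\le\frac12\qquad\text{for all } i\in\mathbb Z .$$ Then the Godunov-type scheme $$w_i^{n+1}=\frac1{\Delta x}\int_0^{\Delta x/2}\widehat{\mathcal W}_R\Big(\frac x{\Delta t},\widetilde w_{i-1}^n,\widetilde w_i^n\Big)dx+\frac1{\Delta x}\int_{-\Delta x/2}^0\widehat{\mathcal W}_R\Big(\frac x{\Delta t},\widetilde w_i^n,\widetilde w_{i+1}^n\Big)dx$$ can be written in the form $$w_i^{n+1}=w_i^n-\frac{\Delta t}{\Delta x}\big(F(\widetilde w_i^n,\widetilde w_{i+1}^n)-F(\widetilde w_{i-1}^n,\widetilde w_i^n)\big)+\frac{\Delta t}{2\Delta x}\big(S(\widetilde w_i^n,\widetilde w_{i+1}^n)+S(\widetilde w_{i-1}^n,\widetilde w_i^n)\big),$$ where $S=(0,S^{hu},S^{hv})^T$ is the numerical source term defined in the context and $F=(F^h,F^{hu},F^{hv})^T$ is given by $$F^h(\widetilde w_L,\widetilde w_R)=\overline{hu}+\frac{\lambda_R}2(h_R^\star-h_R)+\frac{\lambda_L}2(h_L^\star-h_L),$$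 $$F^{hu}(\widetilde w_L,\widetilde w_R)=\overline{hu^2+\tfrac{gh^2}2}+\frac{\lambda_R}2(h_R^\star u_R^\star-h_Ru_R)+\frac{\lambda_L}2(h_L^\star u_L^\star-h_Lu_L),$$ $$F^{hv}(\widetilde w_L,\widetilde w_R)=\overline{huv}+\frac{\lambda_R}2(h_R^\star v_R^\star-h_Rv_R)+\frac{\lambda_L}2(h_L^\star v_L^\star-h_Lv_L).$$ Moreover, this scheme is fully well-balanced, i.e. if $(\widetilde w_i^n)_{i\in\mathbb Z}$ is a discrete steady state then $w_i^{n+1}=w_i^n$ for all $i\in\mathbb Z$; and it preserves the positivity of $h$, i.e. if $h_i^n>0$ for all $i\in\mathbb Z$ then $h_i^{n+1}>0$ for all $i\in\mathbb Z$.
   Context: Constants: $g>0$ (gravity), $f\in\mathbb R$ (Coriolis parameter), $\varepsilon>0$ (small threshold). The system is the 1D rotating shallow water system $\partial_t h+\partial_x(hu)=0$, $\partial_t(hu)+\partial_x(hu^2+gh^2/2)=fhv-gh\,\partial_xz$, $\partial_t(hv)+\partial_x(huv)=-fhu$. States are $w=(h,hu,hv)^T\in\Omega=\{w\in\mathbb R^3:h>0\}$, with flux $\Phi(w)=(hu,\,hu^2+gh^2/2,\,huv)^T$; $\widetilde w=(w,z)\in\widetilde\Omega=\{(h,hu,hv,z)^T\in\mathbb R^4:h>0\}$, where $z$ is the (time-independent) topography value. Notation: for a quantity $X$ with left and right values, $[X]=X_R-X_L$ and $\overline X=(X_L+X_R)/2$. Steady states: for $(\widetilde w_L,\widetilde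 w_R)\in\widetilde\Omega^2$ let $$\mathcal E_{LR}=\sqrt{\big|[hu]\big|^2+\Big|\big[\tfrac{u^2}2+g(h+z)\big]-\Delta x\,f\,\overline v\Big|^2+\big|\overline{hu}\,([v]+f\Delta x)\big|^2}.$$ The pair is a local steady state if $\mathcal E_{LR}=0$, equivalently $h_Ru_R=h_Lu_L=q$, $[\tfrac{u^2}{2}+g(h+z)]=\Delta x f\overline v$, $q[v]=-\Delta x fq$. A sequence $(\widetilde w_i)_{i\in\mathbb Z}$ is a discrete steady state if $(\widetilde w_i,\widetilde w_{i+1})$ is a local steady state for every $i$. Numerical source term: let $\mathrm{Fr}=\frac{\overline h\,|u_Lu_R|}{g\,h_Lh_R}$, and let $\widetilde q=\widetilde q(\widetilde w_L,\widetilde w_R)$ be a fixed real-valued function that equals the common discharge $q=h_Lu_L=h_Ru_R$ whenever $(\widetilde w_L,\widetilde w_R)$ is a local steady state and equals $hu$ whenever $w_L=w_R=w$ (for instance $\widetilde q=\overline{hu}$). Set $$S^{hu}=\begin{cases}\Delta x f\,\overline h\,\overline v-g\overline h[z]+\dfrac{g\,\mathrm{Fr}\,[h]}{4\overline h}\,\dfrac{(\Delta xf\overline v/g-[z])^2}{(1-\mathrm{Fr})^2+\mathcal E_{LR}}&\text{if }\mathrm{Fr}\ne1\text{ or }\mathcal E_{LR}\neq0,\\[1em]\dfrac{g}{4\overline h}[h]^3&\text{if }\mathrm{Fr}=1\text{ and }\mathcal E_{LR}=0,\end{cases}\qquad S^{hv}=-\Delta x f\,\widetilde q .$$ Approximate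 Riemann solver: with wave speeds $\lambda_L=\lambda_L(\widetilde w_L,\widetilde w_R)<0<\lambda_R=\lambda_R(\widetilde w_L,\widetilde w_R)$, $$\widehat{\mathcal W}_R(\xi,\widetilde w_L,\widetilde w_R)=\begin{cases}w_L&\xi<\lambda_L\\ w_L^\star&\lambda_L<\xi<0\\ w_R^\star&0<\xi<\lambda_R\\ w_R&\xi>\lambda_R\end{cases}$$ where $w^\star_{L}=(h_L^\star,h_L^\star u_L^\star,h_L^\star v_L^\star)^T$, $w^\star_{R}=(h_R^\star,h_R^\star u_R^\star,h_R^\star v_R^\star)^T$ are defined as follows. Let $$w^{HLL}=(h^{HLL},(hu)^{HLL},(hv)^{HLL})^T=\frac{\lambda_Rw_R-\lambda_Lw_L}{\lambda_R-\lambda_L}-\frac{\Phi(w_R)-\Phi(w_L)}{\lambda_R-\lambda_L},\quad \alpha_{LR}=g\overline h-|u_Lu_R|,\quad \delta=\min(\varepsilon,h_L,h_R,h^{HLL}),$$ $$\Delta^h_{LR}=\begin{cases}\dfrac{\alpha_{LR}S^{hu}}{\alpha_{LR}^2+\mathcal E_{LR}}&\mathcal E_{LR}\ne0\\ h_R-h_L&\mathcal E_{LR}=0\end{cases},\qquad \Delta^v_{LR}=\begin{cases}\dfrac{\widetilde q\,S^{hv}}{\widetilde q^2+\mathcal E_{LR}}&\mathcal E_{LR}\ne0\\ v_R-v_L&\mathcal E_{LR}=0\end{cases}.$$ Then $$h_L^\star u_L^\star=h_R^\star u_R^\star=q^\star=(hu)^{HLL}+\frac{S^{hu}}{\lambda_R-\lambda_L},$$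 $$h_L^\star=\min\Big(\max\big(h^{HLL}-\tfrac{\lambda_R}{\lambda_R-\lambda_L}\Delta^h_{LR},\delta\big),\big(1-\tfrac{\lambda_R}{\lambda_L}\big)h^{HLL}+\tfrac{\lambda_R}{\lambda_L}\delta\Big),$$ $$h_R^\star=\min\Big(\max\big(h^{HLL}-\tfrac{\lambda_L}{\lambda_R-\lambda_L}\Delta^h_{LR},\delta\big),\big(1-\tfrac{\lambda_L}{\lambda_R}\big)h^{HLL}+\tfrac{\lambda_L}{\lambda_R}\delta\Big),$$ $$v_L^\star=\frac{(hv)^{HLL}}{h^{HLL}}+\frac{S^{hv}-\lambda_Rh_R^\star\Delta^v_{LR}}{(\lambda_R-\lambda_L)h^{HLL}},\qquad v_R^\star=\frac{(hv)^{HLL}}{h^{HLL}}+\frac{S^{hv}-\lambda_Lh_L^\star\Delta^v_{LR}}{(\lambda_R-\lambda_L)h^{HLL}}.$$ *)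

(* Defs.v *)
From Stdlib Require Import Reals ZArith.
From Coquelicot Require Import Coquelicot.
Open Scope R_scope.

(** States are the conserved variables [(h, hu, hv)]; [R * R * R] carries
    Coquelicot's [plus], [minus] and [scal]. *)
Definition state : Type := (R * R * R)%type.

Definition h (w : state) : R := fst (fst w).
Definition hu (w : state) : R := snd (fst w).
Definition hv (w : state) : R := snd w.
Definition u (w : state) : R := hu w / h w.
Definition v (w : state) : R := hv w / h w.

Record tstate : Type := TState { st :> state; topo : R }.

(** Through the coercion [st], this is also membership in the set of admissible
    [tstate]s. *)
Definition Omega (w : state) : Prop := 0 < h w.

Definition jump {T : Type} (X : T -> R) (wL wR : T) : R := X wR - X wL.
Definition mean {T : Type} (X : T -> R) (wL wR : T) : R := (X wL + X wR) / 2.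

(** Coquelicot has no [CompleteNormedModule] structure on products, hence no
    [RInt] for [state]-valued functions: integrate componentwise. *)
Definition RInt_state (phi : R -> state) (a b : R) : state :=
  (RInt (fun x => h (phi x)) a b,
   RInt (fun x => hu (phi x)) a b,
   RInt (fun x => hv (phi x)) a b).

Section RotatingShallowWater.

Variables g f eps dx : R.
Variables lamL lamR : tstate -> tstate -> R.
Variable qt : tstate -> tstate -> R.

Definition momentum_flux (w : state) : R := h w * u w ^ 2 + g * h w ^ 2 / 2.
Definition transverse_flux (w : state) : R := h w * u w * v w.
Definition Phi (w : state) : state := (hu w, momentum_flux w, transverse_flux w).

(** * Steady states *)

Definition steady_err (wL wR : tstate) : R :=
  sqrt (Rabs (jump hu wL wR) ^ 2
        + Rabs (jump (fun w : tstate => u w ^ 2 / 2 + g * (h w + topo w)) wL wR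
                - dx * f * mean v wL wR) ^ 2
        + Rabs (mean hu wL wR * (jump v wL wR + f * dx)) ^ 2).

Definition local_steady_state (wL wR : tstate) : Prop := steady_err wL wR = 0.

Definition discrete_steady_state (w : Z -> tstate) : Prop :=
  forall i : Z, local_steady_state (w i) (w (i + 1)%Z).

(** * Numerical source term *)

Definition Fr (wL wR : state) : R :=
  mean h wL wR * Rabs (u wL * u wR) / (g * h wL * h wR).

Definition discharge_consistent : Prop :=
  forall wL wR : tstate, Omega wL -> Omega wR ->
    (local_steady_state wL wR -> qt wL wR = hu wL) /\
    (st wL = st wR -> qt wL wR = hu wL).

Definition Shu (wL wR : tstate) : R :=
  match Req_dec_T (Fr wL wR) 1, Req_dec_T (steady_err wL wR) 0 with
  | left _, left _ => g / (4 * mean h wL wR) * jump h wL wR ^ 3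
  | _, _ =>
      dx * f * mean h wL wR * mean v wL wR
      - g * mean h wL wR * jump topo wL wR
      + g * Fr wL wR * jump h wL wR / (4 * mean h wL wR)
        * ((dx * f * mean v wL wR / g - jump topo wL wR) ^ 2
           / ((1 - Fr wL wR) ^ 2 + steady_err wL wR))
  end.

Definition Shv (wL wR : tstate) : R := - (dx * f * qt wL wR).

Definition S_num (wL wR : tstate) : state := (0, Shu wL wR, Shv wL wR).

(** * Approximate Riemann solver *)

Definition wave_speeds_admissible : Prop :=
  forall wL wR : tstate, Omega wL -> Omega wR ->
    lamL wL wR < 0 < lamR wL wR /\ lamL wL wR < u wL /\ u wR < lamR wL wR.

Definition w_HLL (wL wR : tstate) : state :=
  minus
    (scal (/ (lamR wL wR - lamL wL wR))
       (minus (scal (lamR wL wR) (st wR)) (scal (lamL wL wR) (st wL))))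
    (scal (/ (lamR wL wR - lamL wL wR)) (minus (Phi wR) (Phi wL))).

Definition h_HLL (wL wR : tstate) : R := h (w_HLL wL wR).
Definition hu_HLL (wL wR : tstate) : R := hu (w_HLL wL wR).
Definition hv_HLL (wL wR : tstate) : R := hv (w_HLL wL wR).

Definition alpha (wL wR : state) : R := g * mean h wL wR - Rabs (u wL * u wR).

Definition delta (wL wR : tstate) : R :=
  Rmin eps (Rmin (h wL) (Rmin (h wR) (h_HLL wL wR))).

Definition Delta_h (wL wR : tstate) : R :=
  if Req_dec_T (steady_err wL wR) 0 then h wR - h wL
  else alpha wL wR * Shu wL wR / (alpha wL wR ^ 2 + steady_err wL wR).

Definition Delta_v (wL wR : tstate) : R :=
  if Req_dec_T (steady_err wL wR) 0 then v wR - v wL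
  else qt wL wR * Shv wL wR / (qt wL wR ^ 2 + steady_err wL wR).

Definition q_star (wL wR : tstate) : R :=
  hu_HLL wL wR + Shu wL wR / (lamR wL wR - lamL wL wR).

Definition hL_star (wL wR : tstate) : R :=
  let lL := lamL wL wR in let lR := lamR wL wR in
  Rmin (Rmax (h_HLL wL wR - lR / (lR - lL) * Delta_h wL wR) (delta wL wR))
       ((1 - lR / lL) * h_HLL wL wR + lR / lL * delta wL wR).

Definition hR_star (wL wR : tstate) : R :=
  let lL := lamL wL wR in let lR := lamR wL wR in
  Rmin (Rmax (h_HLL wL wR - lL / (lR - lL) * Delta_h wL wR) (delta wL wR))
       ((1 - lL / lR) * h_HLL wL wR + lL / lR * delta wL wR).

Definition vL_star (wL wR : tstate) : R :=
  let lL := lamL wL wR in let lR := lamR wL wR in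
  hv_HLL wL wR / h_HLL wL wR
  + (Shv wL wR - lR * hR_star wL wR * Delta_v wL wR)
    / ((lR - lL) * h_HLL wL wR).

Definition vR_star (wL wR : tstate) : R :=
  let lL := lamL wL wR in let lR := lamR wL wR in
  hv_HLL wL wR / h_HLL wL wR
  + (Shv wL wR - lL * hL_star wL wR * Delta_v wL wR)
    / ((lR - lL) * h_HLL wL wR).

Definition wL_star (wL wR : tstate) : state :=
  (hL_star wL wR, q_star wL wR, hL_star wL wR * vL_star wL wR).

Definition wR_star (wL wR : tstate) : state :=
  (hR_star wL wR, q_star wL wR, hR_star wL wR * vR_star wL wR).

(** The values of the solver on the waves [xi = lamL], [xi = 0], [xi = lamR]
    are left unspecified. *)
Definition is_riemann_solver (W : R -> tstate -> tstate -> state) : Prop :=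
  forall (wL wR : tstate), Omega wL -> Omega wR -> forall xi : R,
    (xi < lamL wL wR -> W xi wL wR = wL) /\
    (lamL wL wR < xi < 0 -> W xi wL wR = wL_star wL wR) /\
    (0 < xi < lamR wL wR -> W xi wL wR = wR_star wL wR) /\
    (lamR wL wR < xi -> W xi wL wR = wR).

(** * The scheme *)

Definition CFL (dt : R) (w : Z -> tstate) : Prop :=
  forall i : Z,
    dt / dx * Rmax (Rabs (lamL (w i) (w (i + 1)%Z)))
                   (Rabs (lamR (w i) (w (i + 1)%Z))) <= 1 / 2.

Definition godunov_step (W : R -> tstate -> tstate -> state) (dt : R)
    (w : Z -> tstate) (i : Z) : state :=
  plus
    (scal (1 / dx)
       (RInt_state (fun x => W (x / dt) (w (i - 1)%Z) (w i)) 0 (dx / 2)))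
    (scal (1 / dx)
       (RInt_state (fun x => W (x / dt) (w i) (w (i + 1)%Z)) (- (dx / 2)) 0)).

Definition F_h (wL wR : tstate) : R :=
  mean hu wL wR
  + lamR wL wR / 2 * (h (wR_star wL wR) - h wR)
  + lamL wL wR / 2 * (h (wL_star wL wR) - h wL).

Definition F_hu (wL wR : tstate) : R :=
  mean momentum_flux wL wR
  + lamR wL wR / 2 * (hu (wR_star wL wR) - hu wR)
  + lamL wL wR / 2 * (hu (wL_star wL wR) - hu wL).

Definition F_hv (wL wR : tstate) : R :=
  mean transverse_flux wL wR
  + lamR wL wR / 2 * (hv (wR_star wL wR) - hv wR)
  + lamL wL wR / 2 * (hv (wL_star wL wR) - hv wL).

Definition F_num (wL wR : tstate) : state :=
  (F_h wL wR, F_hu wL wR, F_hv wL wR).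

Definition flux_source_step (dt : R) (w : Z -> tstate) (i : Z) : state :=
  plus
    (minus (st (w i))
       (scal (dt / dx)
          (minus (F_num (w i) (w (i + 1)%Z)) (F_num (w (i - 1)%Z) (w i)))))
    (scal (dt / (2 * dx))
       (plus (S_num (w i) (w (i + 1)%Z)) (S_num (w (i - 1)%Z) (w i)))).

End RotatingShallowWater.

(* Main.v *)
(** Write [w*L, w*R] for the intermediate states, [[X]] for a jump and
    [S = (0, Shu, Shv)].  The clipped depths still satisfy
    [lamR h*R - lamL h*L = (lamR - lamL) hHLL], because the affine map
    [x |-> ((lamR - lamL) hHLL + lamL x) / lamR] is decreasing and exchanges the
    two bounds imposed on [h*L] with those imposed on [h*R].  Hence the solver is
    consistent,
    [lamR (w*R - wR) - lamL (w*L - wL) = S - [Phi]],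
    and the numerical flux equals both [Phi wL + lamL (w*L - wL) + S / 2] and
    [Phi wR + lamR (w*R - wR) - S / 2].  On the other hand, integrating the solver gives
    [w_i + dt/dx (lamR (w*R - wR)(i-1,i) - lamL (w*L - wL)(i,i+1))], so the two
    forms of the scheme agree.  On a local steady state [[Phi] = S], which forces
    [w*L = wL] and [w*R = wR].  Under the CFL condition the updated depth is a
    convex combination of positive depths. *)

Require Import Defs.
From Stdlib Require Import Reals ZArith Lra Lia.
From Coquelicot Require Import Coquelicot.
Open Scope R_scope.

(** * Integrals of two-valued functions and clipping *)

Lemma state_ext (a b : state) : h a = h b -> hu a = hu b -> hv a = hv b -> a = b.
Proof.
  destruct a as [[a1 a2] a3], b as [[b1 b2] b3]; cbn; intros -> -> ->; reflexivity.
Qed.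

(** Only open subintervals matter, so the unspecified values of the solver on its waves are
    harmless. *)
Lemma is_RInt_two_values (phi : R -> R) (a b c p q : R) :
  a <= c <= b ->
  (forall x, a < x < c -> phi x = p) ->
  (forall x, c < x < b -> phi x = q) ->
  is_RInt phi a b ((c - a) * p + (b - c) * q).
Proof.
  intros [Hac Hcb] Hp Hq.
  apply (is_RInt_Chasles (V := R_NormedModule) phi a c b ((c - a) * p) ((b - c) * q)).
  - apply (is_RInt_ext (fun _ => p)).
    + intros x; rewrite Rmin_left, Rmax_right by lra; intros Hx; symmetry; auto.
    + apply (is_RInt_const (V := R_NormedModule) a c p).
  - apply (is_RInt_ext (fun _ => q)).
    + intros x; rewrite Rmin_left, Rmax_right by lra; intros Hx; symmetry; auto.
    + apply (is_RInt_const (V := R_NormedModule) c b q).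
Qed.

Lemma RInt_state_two_values (phi : R -> state) (a b c : R) (p q : state) :
  a <= c <= b ->
  (forall x, a < x < c -> phi x = p) ->
  (forall x, c < x < b -> phi x = q) ->
  RInt_state phi a b = plus (scal (c - a) p) (scal (b - c) q).
Proof.
  intros Hc Hp Hq.
  apply state_ext; apply is_RInt_unique; cbn; apply is_RInt_two_values; trivial;
    intros x Hx; rewrite ?(Hp x Hx), ?(Hq x Hx); reflexivity.
Qed.

(** For [d <= X], [Rmin (Rmax a d) X] is the median of [d], [a], [X]; it commutes
    with the decreasing map [x |-> (K + lL x) / lR]. *)
Lemma clip_balance (lL lR K a b d X Y : R) :
  lL < 0 < lR -> d <= X ->
  lR * b - lL * a = K -> lR * Y - lL * d = K -> lR * d - lL * X = K ->
  lR * Rmin (Rmax b d) Y - lL * Rmin (Rmax a d) X = K.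
Proof.
  intros Hl HdX Hab HYd HdXK.
  assert (Hmono : forall x y x' y', lR * y - lL * x = K -> lR * y' - lL * x' = K ->
            x <= x' -> y' <= y) by (intros; nra).
  assert (HdY : d <= Y) by (apply (Hmono d Y X d); lra).
  (* Three cases: [a] lies below, inside or above [[d, X]]; by [Hmono], [b] then lies above, inside
     or below [[d, Y]]. *)
  destruct (Rle_dec a d) as [Had | Had].
  - assert (Y <= b) by (apply (Hmono a b d Y); lra).
    rewrite (Rmax_right a d), (Rmax_left b d), (Rmin_left d X), (Rmin_right b Y) by lra; lra.
  - assert (b <= Y) by (apply (Hmono d Y a b); lra).
    destruct (Rle_dec a X) as [HaX | HaX].
    + assert (d <= b) by (apply (Hmono a b X d); lra).
      rewrite (Rmax_left a d), (Rmax_left b d), (Rmin_left a X), (Rmin_left b Y) by lra; lra.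
    + assert (b <= d) by (apply (Hmono X d a b); lra).
      rewrite (Rmax_left a d), (Rmax_right b d), (Rmin_right a X), (Rmin_left d Y) by lra; lra.
Qed.

Section Solver.

Variables (g f eps dx : R) (lamL lamR qt : tstate -> tstate -> R).
Hypothesis g_pos : 0 < g.
Hypothesis eps_pos : 0 < eps.
Hypothesis dx_pos : 0 < dx.
Hypothesis qt_consistent : discharge_consistent g f dx qt.
Hypothesis lam_admissible : wave_speeds_admissible lamL lamR.

(** * Intermediate states at one interface *)

Section Pair.

Variables wL wR : tstate.
Hypothesis OmL : Omega wL.
Hypothesis OmR : Omega wR.

Local Notation lL := (lamL wL wR).
Local Notation lR := (lamR wL wR).
Local Notation hH := (h_HLL g lamL lamR wL wR).
Local Notation d := (delta g eps lamL lamR wL wR).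
Local Notation hLs := (hL_star g f eps dx lamL lamR wL wR).
Local Notation hRs := (hR_star g f eps dx lamL lamR wL wR).
Local Notation vLs := (vL_star g f eps dx lamL lamR qt wL wR).
Local Notation vRs := (vR_star g f eps dx lamL lamR qt wL wR).
Local Notation qs := (q_star g f dx lamL lamR wL wR).
Local Notation wLs := (wL_star g f eps dx lamL lamR qt wL wR).
Local Notation wRs := (wR_star g f eps dx lamL lamR qt wL wR).

Lemma lam_sign : lL < 0 < lR.
Proof. destruct (lam_admissible wL wR OmL OmR) as [Hl _]; exact Hl. Qed.

Lemma w_HLL_eq (X : state -> R) :
  (forall a b, X (minus a b) = X a - X b) -> (forall k a, X (scal k a) = k * X a) ->
  (lR - lL) * X (w_HLL g lamL lamR wL wR)
  = lR * X wR - lL * X wL - (X (Phi g wR) - X (Phi g wL)).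
Proof.
  intros Hm Hs; unfold w_HLL; rewrite !Hm, !Hs, !Hm, !Hs.
  pose proof lam_sign; field; lra.
Qed.

Lemma h_HLL_eq : (lR - lL) * hH = lR * h wR - lL * h wL - (hu wR - hu wL).
Proof. apply (w_HLL_eq h); reflexivity. Qed.

Lemma hu_HLL_eq :
  (lR - lL) * hu_HLL g lamL lamR wL wR
  = lR * hu wR - lL * hu wL - (momentum_flux g wR - momentum_flux g wL).
Proof. apply (w_HLL_eq hu); reflexivity. Qed.

Lemma hv_HLL_eq :
  (lR - lL) * hv_HLL g lamL lamR wL wR
  = lR * hv wR - lL * hv wL - (transverse_flux wR - transverse_flux wL).
Proof. apply (w_HLL_eq hv); reflexivity. Qed.

(** The numerator is [(lR - uR) hR + (uL - lL) hL], and the wave speeds enclose the velocities. *)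
Lemma h_HLL_pos : 0 < hH.
Proof.
  pose proof lam_sign as Hl; pose proof h_HLL_eq as HH.
  destruct (lam_admissible wL wR OmL OmR) as (_ & HuL & HuR).
  unfold Omega in OmL, OmR.
  assert (EL : hu wL = h wL * u wL) by (unfold u; field; lra).
  assert (ER : hu wR = h wR * u wR) by (unfold u; field; lra).
  apply (Rmult_lt_reg_l (lR - lL)); [lra |].
  rewrite HH, EL, ER, Rmult_0_r.
  assert (0 < (lR - u wR) * h wR) by (apply Rmult_lt_0_compat; lra).
  assert (0 < (u wL - lL) * h wL) by (apply Rmult_lt_0_compat; lra).
  lra.
Qed.

Lemma delta_pos : 0 < d.
Proof. unfold delta; repeat apply Rmin_glb_lt; trivial; apply h_HLL_pos. Qed.

Lemma delta_le : d <= h wL /\ d <= h wR /\ d <= hH.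
Proof.
  unfold delta.
  pose proof (Rmin_r eps (Rmin (h wL) (Rmin (h wR) hH))).
  pose proof (Rmin_l (h wL) (Rmin (h wR) hH)).
  pose proof (Rmin_r (h wL) (Rmin (h wR) hH)).
  pose proof (Rmin_l (h wR) hH).
  pose proof (Rmin_r (h wR) hH).
  lra.
Qed.

(** The upper bound on the left depth is what mass balance leaves there when the right depth is
    [delta]. *)
Lemma upper_bound_L_eq :
  lR * d - lL * ((1 - lR / lL) * hH + lR / lL * d) = (lR - lL) * hH.
Proof. pose proof lam_sign; field; lra. Qed.

Lemma upper_bound_R_eq :
  lR * ((1 - lL / lR) * hH + lL / lR * d) - lL * d = (lR - lL) * hH.
Proof. pose proof lam_sign; field; lra. Qed.

(** The bound equals [hH + (- lR / lL) * (hH - d)], and [d <= hH]. *)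
Lemma upper_bound_L_ge : d <= (1 - lR / lL) * hH + lR / lL * d.
Proof.
  pose proof lam_sign; pose proof upper_bound_L_eq; destruct delta_le as (_ & _ & Hd); nra.
Qed.

Lemma upper_bound_R_ge : d <= (1 - lL / lR) * hH + lL / lR * d.
Proof.
  pose proof lam_sign; pose proof upper_bound_R_eq; destruct delta_le as (_ & _ & Hd); nra.
Qed.

Lemma hL_star_pos : 0 < hLs.
Proof.
  pose proof delta_pos; pose proof upper_bound_L_ge.
  unfold hL_star; cbv zeta; apply Rmin_glb_lt; [| lra].
  eapply Rlt_le_trans; [| apply Rmax_r]; lra.
Qed.

Lemma hR_star_pos : 0 < hRs.
Proof.
  pose proof delta_pos; pose proof upper_bound_R_ge.
  unfold hR_star; cbv zeta; apply Rmin_glb_lt; [| lra].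
  eapply Rlt_le_trans; [| apply Rmax_r]; lra.
Qed.

Lemma h_star_balance : lR * hRs - lL * hLs = (lR - lL) * hH.
Proof.
  pose proof lam_sign.
  unfold hL_star, hR_star; cbv zeta; apply clip_balance.
  - exact lam_sign.
  - exact upper_bound_L_ge.
  - field; lra.
  - exact upper_bound_R_eq.
  - exact upper_bound_L_eq.
Qed.

Lemma q_star_balance :
  (lR - lL) * qs = (lR - lL) * hu_HLL g lamL lamR wL wR + Shu g f dx wL wR.
Proof. pose proof lam_sign; unfold q_star; field; lra. Qed.

(** The [Delta_v] terms of both sides carry the same product [lL * lR * hLs * hRs] and cancel. What
    is left is a velocity common to both sides, weighted by the mass balance. *)
Lemma hv_star_balance :
  lR * (hRs * vRs) - lL * (hLs * vLs)
  = (lR - lL) * hv_HLL g lamL lamR wL wR + Shv f dx qt wL wR.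
Proof.
  pose proof lam_sign; pose proof h_HLL_pos; pose proof h_star_balance as Hb.
  unfold vL_star, vR_star; cbv zeta.
  set (D := Delta_v _ _ _ _ _ _); set (s := Shv _ _ _ _ _); set (B := hv_HLL _ _ _ _ _).
  transitivity ((lR * hRs - lL * hLs) * (B / hH + s / ((lR - lL) * hH))).
  - field; lra.
  - rewrite Hb; field; lra.
Qed.

Lemma solver_consistency (X : state -> R) :
  X = h \/ X = hu \/ X = hv ->
  lR * (X wRs - X wR) - lL * (X wLs - X wL)
  = X (S_num g f dx qt wL wR) - (X (Phi g wR) - X (Phi g wL)).
Proof.
  pose proof h_star_balance; pose proof h_HLL_eq.
  pose proof q_star_balance; pose proof hu_HLL_eq.
  pose proof hv_star_balance; pose proof hv_HLL_eq.
  intros [-> | [-> | ->]]; cbn; lra.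
Qed.

(** [F_num] is the average of this expression and the one in [F_num_right]; [solver_consistency]
    makes the two equal. *)
Lemma F_num_left (X : state -> R) :
  X = h \/ X = hu \/ X = hv ->
  X (F_num g f eps dx lamL lamR qt wL wR)
  = X (Phi g wL) + lL * (X wLs - X wL) + X (S_num g f dx qt wL wR) / 2.
Proof.
  intros HX; pose proof (solver_consistency X HX) as C; revert C.
  destruct HX as [-> | [-> | ->]]; cbn;
    unfold F_h, F_hu, F_hv, mean; cbn; lra.
Qed.

Lemma F_num_right (X : state -> R) :
  X = h \/ X = hu \/ X = hv ->
  X (F_num g f eps dx lamL lamR qt wL wR)
  = X (Phi g wR) + lR * (X wRs - X wR) - X (S_num g f dx qt wL wR) / 2.
Proof.
  intros HX; pose proof (solver_consistency X HX) as C.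
  rewrite F_num_left by exact HX; lra.
Qed.

(** * Exactness on local steady states *)

Hypothesis steady : local_steady_state g f dx wL wR.

Lemma steady_relations :
  hu wR = hu wL /\
  u wR ^ 2 / 2 + g * (h wR + topo wR) - (u wL ^ 2 / 2 + g * (h wL + topo wL))
    = dx * f * mean v wL wR /\
  hu wL * (v wR - v wL) = - (dx * f * hu wL).
Proof.
  pose proof steady as E; unfold local_steady_state, steady_err in E.
  rewrite !pow2_abs in E; apply sqrt_eq_0 in E.
  2: repeat apply Rplus_le_le_0_compat; apply pow2_ge_0.
  unfold jump in E.
  set (a := hu wR - hu wL) in *.
  set (b := _ - dx * f * mean _ _ _) in *.
  set (c := mean _ _ _ * _) in *.
  assert (a = 0 /\ b = 0 /\ c = 0) as (Ha & Hb & Hc).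
  { pose proof (pow2_ge_0 a); pose proof (pow2_ge_0 b); pose proof (pow2_ge_0 c).
    repeat split; apply Rsqr_0_uniq; unfold Rsqr; lra. }
  unfold a, b, c, mean in *.
  repeat split; try lra.
  replace ((hu wL + hu wR) / 2) with (hu wL) in Hc by lra; lra.
Qed.

Lemma Shu_steady : Shu g f dx wL wR = momentum_flux g wR - momentum_flux g wL.
Proof.
  destruct steady_relations as (Hq & HB & _).
  unfold Omega in OmL, OmR.
  assert (Hmean : mean h wL wR <> 0) by (unfold mean; lra).
  (* With a common discharge [q], the product [uL * uR] is [q^2 / (hL * hR) >= 0], so the absolute
     value in [Fr] disappears. *)
  set (Fr0 := hu wL ^ 2 * mean h wL wR / (g * h wL ^ 2 * h wR ^ 2)).
  assert (HFr : Fr g wL wR = Fr0).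
  { unfold Fr, Fr0, u; rewrite Hq.
    rewrite Rabs_pos_eq.
    - field; lra.
    - replace (hu wL / h wL * (hu wL / h wR)) with (hu wL ^ 2 / (h wL * h wR)) by (field; lra).
      apply Rmult_le_pos; [apply pow2_ge_0 | left; apply Rinv_0_lt_compat, Rmult_lt_0_compat; lra]. }
  (* Bernoulli's relation: for a common discharge, the jump of [u^2 / 2] is [- g * Fr0 * [h]]. *)
  assert (HA : dx * f * mean v wL wR - g * jump topo wL wR = g * jump h wL wR * (1 - Fr0)).
  { rewrite <- HB; unfold jump, Fr0, mean, u; rewrite Hq; field; lra. }
  (* This rests on [mean h ^ 2 - [h]^2 / 4 = hL * hR]. *)
  assert (Hcubic : mean h wL wR * (g * jump h wL wR * (1 - Fr0))
                   + g * Fr0 * jump h wL wR ^ 3 / (4 * mean h wL wR)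
                   = momentum_flux g wR - momentum_flux g wL).
  { unfold momentum_flux, Fr0, jump, mean, u; rewrite Hq; field; lra. }
  unfold Shu; rewrite <- Hcubic.
  pose proof steady as E; unfold local_steady_state in E; rewrite HFr, E.
  replace (dx * f * mean v wL wR / g - jump topo wL wR) with (jump h wL wR * (1 - Fr0)).
  2: { transitivity ((dx * f * mean v wL wR - g * jump topo wL wR) / g);
       [rewrite HA |]; field; lra. }
  replace (dx * f * mean h wL wR * mean v wL wR - g * mean h wL wR * jump topo wL wR)
    with (mean h wL wR * (g * jump h wL wR * (1 - Fr0))) by (rewrite <- HA; ring).
  (* Away from [Fr0 = 1] the factor [(1 - Fr0)^2] cancels and leaves the cubic term; at [Fr0 = 1]
     the definition supplies that term directly. *)
  destruct (Req_dec_T Fr0 1) as [H1 | H1]; destruct (Req_dec_T 0 0) as [H0 | H0];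
    try (now contradiction H0).
  - rewrite H1; field; lra.
  - field; lra.
Qed.

(** The transverse flux is [q * v] with a common [q], so its jump is [q [v] = - dx f q]. *)
Lemma Shv_steady : Shv f dx qt wL wR = transverse_flux wR - transverse_flux wL.
Proof.
  destruct steady_relations as (Hq & _ & Hv).
  unfold Shv; rewrite (proj1 (qt_consistent wL wR OmL OmR) steady), <- Hv.
  unfold Omega in OmL, OmR.
  unfold transverse_flux.
  replace (h wR * u wR) with (hu wL) by (unfold u; rewrite Hq; field; lra).
  replace (h wL * u wL) with (hu wL) by (unfold u; field; lra).
  ring.
Qed.

Lemma h_star_steady : hLs = h wL /\ hRs = h wR.
Proof.
  destruct steady_relations as (Hq & _ & _).
  pose proof lam_sign as Hl; pose proof h_HLL_eq as HH; rewrite Hq in HH.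
  destruct delta_le as (HdL & HdR & _).
  pose proof upper_bound_L_eq; pose proof upper_bound_R_eq.
  unfold hL_star, hR_star, Delta_h; cbv zeta.
  destruct (Req_dec_T _ 0) as [_ | E]; [| now contradiction E].
  replace (hH - lR / (lR - lL) * (h wR - h wL)) with (h wL)
    by (apply (Rmult_eq_reg_l (lR - lL)); [field_simplify; lra | lra]).
  replace (hH - lL / (lR - lL) * (h wR - h wL)) with (h wR)
    by (apply (Rmult_eq_reg_l (lR - lL)); [field_simplify; lra | lra]).
  (* Clipping is inactive: [delta] is at most [hL] and [hR], and through the mass balance each lower
     bound gives the upper bound on the other side. *)
  rewrite !Rmax_left, !Rmin_left by nra; split; reflexivity.
Qed.

Lemma star_steady : wLs = st wL /\ wRs = st wR.
Proof.
  destruct steady_relations as (Hq & _ & _).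
  destruct h_star_steady as [HhL HhR].
  pose proof lam_sign; pose proof h_HLL_pos; pose proof h_HLL_eq as HH.
  pose proof hv_HLL_eq as HV; pose proof hu_HLL_eq as HU.
  pose proof q_star_balance as HQ.
  rewrite Shu_steady in HQ; rewrite Hq in HH, HU.
  assert (Hqs : qs = hu wL) by (apply (Rmult_eq_reg_l (lR - lL)); lra).
  assert (EL : hv wL = h wL * v wL) by (unfold v, Omega in *; field; lra).
  assert (ER : hv wR = h wR * v wR) by (unfold v, Omega in *; field; lra).
  assert (HD : Delta_v g f dx qt wL wR = v wR - v wL).
  { unfold Delta_v; destruct (Req_dec_T _ 0) as [_ | E]; [reflexivity | now contradiction E]. }
  rewrite EL, ER in HV.
  assert (HvL : vLs = v wL).
  { unfold vL_star; cbv zeta; rewrite HhR, HD, Shv_steady.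
    transitivity (((lR - lL) * hv_HLL g lamL lamR wL wR
                   + (transverse_flux wR - transverse_flux wL)
                   - lR * h wR * (v wR - v wL)) / ((lR - lL) * hH)); [field; lra |].
    (* The flux jumps cancel, and the numerator becomes [vL * (lR * hR - lL * hL)]. *)
    rewrite HV.
    transitivity (v wL * ((lR - lL) * hH) / ((lR - lL) * hH)); [| field; lra].
    f_equal; rewrite HH; ring. }
  assert (HvR : vRs = v wR).
  { unfold vR_star; cbv zeta; rewrite HhL, HD, Shv_steady.
    transitivity (((lR - lL) * hv_HLL g lamL lamR wL wR
                   + (transverse_flux wR - transverse_flux wL)
                   - lL * h wL * (v wR - v wL)) / ((lR - lL) * hH)); [field; lra |].
    rewrite HV.
    transitivity (v wR * ((lR - lL) * hH) / ((lR - lL) * hH)); [| field; lra].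
    f_equal; rewrite HH; ring. }
  split; apply state_ext; cbn; congruence.
Qed.

End Pair.

(** * The scheme on the whole mesh *)

Section Scheme.

Variables (dt : R) (W : R -> tstate -> tstate -> state) (w : Z -> tstate).
Hypothesis dt_pos : 0 < dt.
Hypothesis W_solver : is_riemann_solver g f eps dx lamL lamR qt W.
Hypothesis w_Omega : forall i, Omega (w i).
Hypothesis w_CFL : CFL dx lamL lamR dt w.

(** At time [dt] the waves are still inside the adjacent half cells, so each half-cell integral sees
    just two states. *)
Lemma CFL_bounds (i : Z) :
  - (dx / 2) <= dt * lamL (w i) (w (i + 1)%Z) /\
  dt * lamR (w i) (w (i + 1)%Z) <= dx / 2.
Proof.
  pose proof (w_CFL i) as C.
  pose proof (lam_sign _ _ (w_Omega i) (w_Omega (i + 1)%Z)).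
  set (l := lamL _ _) in *; set (r := lamR _ _) in *; set (M := Rmax _ _) in *.
  assert (HL : - l <= M) by (unfold M; rewrite <- (Rabs_left l) by lra; apply Rmax_l).
  assert (HR : r <= M) by (unfold M; rewrite <- (Rabs_pos_eq r) at 1 by lra; apply Rmax_r).
  assert (HM : dt * M <= dx / 2).
  { apply (Rmult_le_compat_l dx) in C; [| lra].
    replace (dx * (dt / dx * M)) with (dt * M) in C by (field; lra); lra. }
  split; nra.
Qed.

Local Notation wLs i := (wL_star g f eps dx lamL lamR qt (w i) (w (i + 1)%Z)).
Local Notation wRs i := (wR_star g f eps dx lamL lamR qt (w i) (w (i + 1)%Z)).
Local Notation lL i := (lamL (w i) (w (i + 1)%Z)).
Local Notation lR i := (lamR (w i) (w (i + 1)%Z)).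

Lemma RInt_state_right_half (i : Z) :
  RInt_state (fun x => W (x / dt) (w i) (w (i + 1)%Z)) 0 (dx / 2)
  = plus (scal (dt * lR i - 0) (wRs i)) (scal (dx / 2 - dt * lR i) (st (w (i + 1)%Z))).
Proof.
  destruct (CFL_bounds i) as [_ C].
  pose proof (lam_sign _ _ (w_Omega i) (w_Omega (i + 1)%Z)) as Hl.
  apply RInt_state_two_values.
  - split; [apply Rmult_le_pos; lra | exact C].
  - intros x Hx; apply (W_solver _ _ (w_Omega i) (w_Omega (i + 1)%Z)).
    split; [apply Rdiv_lt_0_compat; lra | apply Rlt_div_l; lra].
  - intros x Hx; apply (W_solver _ _ (w_Omega i) (w_Omega (i + 1)%Z)).
    apply Rlt_div_r; lra.
Qed.

Lemma RInt_state_left_half (i : Z) :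
  RInt_state (fun x => W (x / dt) (w i) (w (i + 1)%Z)) (- (dx / 2)) 0
  = plus (scal (dt * lL i - - (dx / 2)) (st (w i))) (scal (0 - dt * lL i) (wLs i)).
Proof.
  destruct (CFL_bounds i) as [C _].
  pose proof (lam_sign _ _ (w_Omega i) (w_Omega (i + 1)%Z)) as Hl.
  apply RInt_state_two_values.
  - split; [exact C | nra].
  - intros x Hx; apply (W_solver _ _ (w_Omega i) (w_Omega (i + 1)%Z)).
    apply Rlt_div_l; lra.
  - intros x Hx; apply (W_solver _ _ (w_Omega i) (w_Omega (i + 1)%Z)).
    split; [apply Rlt_div_r; lra | apply Rlt_div_l; lra].
Qed.

(** Indexing the cell by [j + 1] gives both of its interfaces the form [(i, i + 1)] used in [CFL]
    and in the integrals. *)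
Lemma godunov_step_succ (j : Z) (X : state -> R) :
  X = h \/ X = hu \/ X = hv ->
  X (godunov_step dx W dt w (j + 1))
  = / dx * (dt * lR j * X (wRs j) + (dx / 2 - dt * lR j) * X (w (j + 1)%Z)
            + (dx / 2 + dt * lL (j + 1)%Z) * X (w (j + 1)%Z)
            - dt * lL (j + 1)%Z * X (wLs (j + 1)%Z)).
Proof.
  intros HX; unfold godunov_step.
  replace (j + 1 - 1)%Z with j by lia.
  rewrite RInt_state_left_half, RInt_state_right_half.
  assert (Hplus : forall a b, X (plus a b) = X a + X b)
    by (destruct HX as [-> | [-> | ->]]; reflexivity).
  assert (Hscal : forall k a, X (scal k a) = k * X a)
    by (destruct HX as [-> | [-> | ->]]; reflexivity).
  rewrite !Hplus, !Hscal, !Hplus, !Hscal; field; lra.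
Qed.

Lemma godunov_step_flux_form (j : Z) :
  godunov_step dx W dt w (j + 1)
  = flux_source_step g f eps dx lamL lamR qt dt w (j + 1).
Proof.
  assert (HX : forall X, X = h \/ X = hu \/ X = hv ->
    X (godunov_step dx W dt w (j + 1))
    = X (w (j + 1)%Z)
      - dt / dx * (X (F_num g f eps dx lamL lamR qt (w (j + 1)%Z) (w (j + 1 + 1)%Z))
                   - X (F_num g f eps dx lamL lamR qt (w j) (w (j + 1)%Z)))
      + dt / (2 * dx) * (X (S_num g f dx qt (w (j + 1)%Z) (w (j + 1 + 1)%Z))
                         + X (S_num g f dx qt (w j) (w (j + 1)%Z)))).
  { intros X HX; rewrite godunov_step_succ by exact HX.
    (* Both interface fluxes are expanded from the side of cell [j + 1], so its physical flux [Phi]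
       cancels in the difference. *)
    rewrite F_num_left, F_num_right by auto; field; lra. }
  unfold flux_source_step; replace (j + 1 - 1)%Z with j by lia.
  apply state_ext; rewrite HX by auto; reflexivity.
Qed.

Lemma godunov_step_steady (j : Z) :
  discrete_steady_state g f dx w -> godunov_step dx W dt w (j + 1) = st (w (j + 1)%Z).
Proof.
  intros Hs.
  assert (HX : forall X, X = h \/ X = hu \/ X = hv ->
    X (godunov_step dx W dt w (j + 1)) = X (w (j + 1)%Z)).
  { intros X HX; rewrite godunov_step_succ by exact HX.
    rewrite (proj2 (star_steady _ _ (w_Omega j) (w_Omega (j + 1)%Z) (Hs j))).
    rewrite (proj1 (star_steady _ _ (w_Omega (j + 1)%Z) (w_Omega (j + 1 + 1)%Z)
                      (Hs (j + 1)%Z))).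
    field; lra. }
  apply state_ext; apply HX; auto.
Qed.

(** The weights of the old depth may vanish when the CFL bound is attained; strict positivity comes
    from the star depths, whose weights are positive. *)
Lemma godunov_step_pos (j : Z) : 0 < h (godunov_step dx W dt w (j + 1)).
Proof.
  rewrite godunov_step_succ by auto.
  destruct (CFL_bounds j) as [_ CR]; destruct (CFL_bounds (j + 1)) as [CL _].
  pose proof (lam_sign _ _ (w_Omega j) (w_Omega (j + 1)%Z)).
  pose proof (lam_sign _ _ (w_Omega (j + 1)%Z) (w_Omega (j + 1 + 1)%Z)).
  pose proof (hR_star_pos _ _ (w_Omega j) (w_Omega (j + 1)%Z)) as HR.
  pose proof (hL_star_pos _ _ (w_Omega (j + 1)%Z) (w_Omega (j + 1 + 1)%Z)) as HL.
  pose proof (w_Omega (j + 1)%Z) as Hh; unfold Omega in Hh.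
  apply Rmult_lt_0_compat; [apply Rinv_0_lt_compat; lra |].
  cbn -[hL_star hR_star].
  assert (0 < dt * lR j * hR_star g f eps dx lamL lamR (w j) (w (j + 1)%Z))
    by (repeat apply Rmult_lt_0_compat; lra).
  assert (0 < dt * - lL (j + 1)%Z
              * hL_star g f eps dx lamL lamR (w (j + 1)%Z) (w (j + 1 + 1)%Z))
    by (repeat apply Rmult_lt_0_compat; lra).
  assert (0 <= (dx / 2 - dt * lR j) * h (w (j + 1)%Z)) by (apply Rmult_le_pos; lra).
  assert (0 <= (dx / 2 + dt * lL (j + 1)%Z) * h (w (j + 1)%Z)) by (apply Rmult_le_pos; lra).
  unfold h in *; lra.
Qed.

End Scheme.

End Solver.

Theorem theorem3p3 (g f eps dx dt : R)
    (lamL lamR qt : tstate -> tstate -> R)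
    (W : R -> tstate -> tstate -> state)
    (w : Z -> tstate) :
  0 < g -> 0 < eps -> 0 < dx -> 0 < dt ->
  discharge_consistent g f dx qt ->
  wave_speeds_admissible lamL lamR ->
  is_riemann_solver g f eps dx lamL lamR qt W ->
  (forall i : Z, Omega (w i)) ->
  CFL dx lamL lamR dt w ->
  (forall i : Z,
     godunov_step dx W dt w i
     = flux_source_step g f eps dx lamL lamR qt dt w i) /\
  (discrete_steady_state g f dx w ->
     forall i : Z, godunov_step dx W dt w i = st (w i)) /\
  ((forall i : Z, 0 < h (w i)) ->
     forall i : Z, 0 < h (godunov_step dx W dt w i)).
Proof.
  intros Hg Heps Hdx Hdt Hqt Hlam HW HOm Hcfl.
  split; [| split]; [| intros Hs | intros _]; intros i;
    replace i with (i - 1 + 1)%Z by lia.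
  - now apply godunov_step_flux_form.
  - now apply (godunov_step_steady g f eps dx lamL lamR qt).
  - now apply (godunov_step_pos g f eps dx lamL lamR qt).
Qed.
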